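(* For every integer $n\ge 1$ there is a bijection from the set $\mathcal{R}_n(021)$ of 021-avoiding repetition sequences of length $n$ to the set of Dyck paths of size $n$ that sends the number of repetitions of a sequence to the number of valleys of the corresponding path. In particular, $|\mathcal{R}_n(021)|=C_n$, the $n$-th Catalan number.
   Context: A repetition sequence of length $n$ is a sequence $a_1a_2\dots a_n$ of nonnegative integers with $a_1=0$ and, for each $i\ge 2$, $a_i\le 1+\#\{j\in[1,i-2]: a_j=a_{j+1}\}$. The number of repetitions of $a_1\dots a_n$ is $\#\{j\in[1,n-1]: a_j=a_{j+1}\}$. A sequence avoids 021 if there are no indices $i<j<k$ with $a_i<a_k<a_j$. A Dyck path of size (semilength) $n$ is a word with $n$ letters $U$ (up steps) and $n$ letters $D$ (down steps) in which every prefix contains at least as many $U$'s as $D$'s. A valley is an occurrence of two consecutive steps $DU$. $C_n=\frac{1}{n+1}\binom{2n}{n}$. *)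

(* Defs.v *)
From mathcomp Require Import all_boot.
From mathcomp Require Import boolp classical_sets functions cardinality.

Set Implicit Arguments.
Unset Strict Implicit.
Unset Printing Implicit Defensive.

(* A sequence a_1 ... a_n is stored as [a : seq nat], with a_i = nth 0 a i.-1.
   [nreps a m] is #{j in [1, m] : a_j = a_(j+1)}. *)
Definition nreps (a : seq nat) (m : nat) : nat :=
  #|[set j : 'I_m | nth 0 a j == nth 0 a j.+1]%SET|.

(* In the bound, the 0-based index i stands for i + 1, so j ranges over
   [1, (i + 1) - 2]. *)
Definition repetition_seq (n : nat) (a : seq nat) : Prop :=
  [/\ size a = n,
      nth 0 a 0 = 0
    & forall i, 1 <= i < n -> nth 0 a i <= 1 + nreps a i.-1].

Definition repetitions (a : seq nat) : nat := nreps a (size a).-1.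

Definition avoids021 (a : seq nat) : Prop :=
  ~ exists i j k : nat,
      [/\ i < j, j < k, k < size a & nth 0 a i < nth 0 a k < nth 0 a j].

Definition R021 (n : nat) : set (seq nat) :=
  [set a | repetition_seq n a /\ avoids021 a]%classic.

Definition U : bool := true.
Definition D : bool := false.

Definition dyck_path (n : nat) (w : seq bool) : Prop :=
  [/\ count_mem U w = n,
      count_mem D w = n
    & forall p, prefix p w -> count_mem D p <= count_mem U p].

Definition Dyck (n : nat) : set (seq bool) := [set w | dyck_path n w]%classic.

Definition valleys (w : seq bool) : nat :=
  #|[set j : 'I_(size w).-1 | (nth U w j == D) && (nth U w j.+1 == U)]%SET|.

Definition catalan (n : nat) : nat := 'C(2 * n, n) %/ n.+1.

(* The division in [catalan] is exact. *)
Lemma catalan_exact (n : nat) : catalan n * n.+1 = 'C(2 * n, n).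
Proof.
apply: divnK; rewrite -(@Gauss_dvdr n.+1 n) ?coprimeSn //.
have := mul_bin_left (2 * n) n; rewrite {2}mul2n -addnn addnK => <-.
exact: dvdn_mulr.
Qed.

(* Main.v *)
Require Import Defs.
From mathcomp Require Import all_boot.
From mathcomp Require Import boolp classical_sets functions cardinality.
From mathcomp Require Import zify.

(* A sequence starting with 0 avoids 021 iff its nonzero letters are weakly
   increasing.  Record after each letter the slack 1 + #repetitions - M, where M
   is the last nonzero letter (M = 1 if there is none).  In every state with slack
   s the possible next letters correspond bijectively to the next slacks
   0, ..., s + 1, and s + 1 is reached exactly by a repetition.  So R_n(021) is in
   bijection with the sequences s_1 = 0, s_(i+1) <= s_i + 1, repetitions becoming
   ascents.  Cutting such a sequence as 0 (P+1) Q makes it a binary tree whose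
   left edges are the ascents; sending the tree to U Q D P gives a Dyck path whose
   valleys are the left edges. *)

Set Implicit Arguments.
Unset Strict Implicit.
Unset Printing Implicit Defensive.

Inductive tree := Leaf | Node of tree & tree.

Definition nonleaf (t : tree) : bool := if t is Leaf then false else true.

Fixpoint tsize (t : tree) : nat :=
  if t is Node p q then (tsize p + tsize q).+1 else 0.

Fixpoint left_edges (t : tree) : nat :=
  if t is Node p q then nonleaf p + left_edges p + left_edges q else 0.

(** * Trees and Dyck paths *)

(* The left subtree comes last: this turns left edges into valleys rather than
   into double rises. *)
Fixpoint path_of (t : tree) : seq bool :=
  if t is Node p q then U :: path_of q ++ D :: path_of p else [::].

Fixpoint balanced (h : nat) (w : seq bool) : bool :=
  match w, h with
  | [::], _ => h == 0
  | true :: w', _ => balanced h.+1 w'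
  | false :: w', h'.+1 => balanced h' w'
  | false :: _, 0 => false
  end.

Lemma balancedP h w :
  reflect (count_mem D w = count_mem U w + h
           /\ forall p, prefix p w -> count_mem D p <= count_mem U p + h)
          (balanced h w).
Proof.
have countE x : (count_mem U (true :: x) = (count_mem U x).+1)
    * (count_mem U (false :: x) = count_mem U x)
    * (count_mem D (true :: x) = count_mem D x)
    * (count_mem D (false :: x) = (count_mem D x).+1) by [].
elim: w h => [|b w IHw] h.
  apply: (iffP eqP) => [->|[]]; last by rewrite /=; lia.
  by split=> // p; case: p.
case: b; rewrite !countE.
- apply: (iffP (IHw _)) => -[e le]; split.
  + lia.
  + case=> [|x p] //; rewrite prefix_cons => /andP[/eqP-> /le]; rewrite !countE; lia.
  + lia.
  + move=> p pw; move: (le (true :: p)); rewrite prefix_cons eqxx => /(_ pw).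
    by rewrite !countE; lia.
case: h => [|h].
  by constructor=> -[_ /(_ [:: false])]; rewrite prefix_cons prefix0s => /(_ isT).
apply: (iffP (IHw _)) => -[e le]; split.
- lia.
- case=> [|x p] //; rewrite prefix_cons => /andP[/eqP-> /le]; rewrite !countE; lia.
- lia.
- move=> p pw; move: (le (false :: p)); rewrite prefix_cons eqxx => /(_ pw).
  by rewrite !countE; lia.
Qed.

Lemma dyck_pathE n w : dyck_path n w <-> size w = 2 * n /\ balanced 0 w.
Proof.
have szE : size w = count_mem D w + count_mem U w.
  by rewrite -(count_predC (pred1 D)) /=; congr (_ + _); apply: eq_count => -[].
split=> [[cU cD le]|[sz /balancedP[e le]]].
  split; first by lia.
  by apply/balancedP; split=> [|p /le]; lia.
by split=> [||p /le]; lia.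
Qed.

Lemma balanced_path_of t h z : balanced h (path_of t ++ z) = balanced h z.
Proof. by elim: t h z => //= p IHp q IHq h z; rewrite -catA IHq /= IHp. Qed.

Lemma size_path_of t : size (path_of t) = 2 * tsize t.
Proof. by elim: t => //= p IHp q IHq; rewrite size_cat /= IHp IHq; lia. Qed.

(** The [D] after [path_of t] is the first step below the starting height, so it marks where the
    code of [t] ends. *)
Lemma path_of_cat_inj t t' z z' :
  path_of t ++ D :: z = path_of t' ++ D :: z' -> t = t' /\ z = z'.
Proof.
elim: t t' z z' => [|p IHp q IHq] [|p' q'] z z' //=; first by case.
case; rewrite -!catA => /IHq[-> /IHp[-> ->]] //.
Qed.

Lemma path_of_inj : injective path_of.
Proof.
move=> t t' e.
by have [] : t = t' /\ [::] = [::] :> seq bool by apply: path_of_cat_inj; rewrite e.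
Qed.

(** Cut [w] at its first passage to each lower level. A leading [U] merges the first two trees into
    a node; a leading [D] puts a leaf in front. For [h = 0] a single tree remains, whence
    surjectivity of [path_of]. *)
Lemma balanced_forest h w : balanced h w ->
  exists t ts, size ts = h /\
    w = path_of t ++ flatten [seq D :: path_of u | u <- ts].
Proof.
elim: w h => [|[] w IHw] h /=.
- by move/eqP->; exists Leaf, [::].
- move/IHw=> [t [[|t' ts] [] // [szts] ->]].
  by exists (Node t' t), ts; rewrite /= -catA.
case: h => // h /IHw[t [ts [<- ->]]].
by exists Leaf, (t :: ts).
Qed.

Lemma path_of_bij n : set_bij [set t | tsize t = n]%classic (Dyck n) path_of.
Proof.
split.
- move=> t /= <-; apply/dyck_pathE; rewrite size_path_of.
  by rewrite -[path_of t]cats0 balanced_path_of.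
- by move=> t t' _ _ /path_of_inj.
- move=> w /dyck_pathE[sz /balanced_forest[t [[|? ?] [] // _ ew]]].
  exists t; last by rewrite ew cats0.
  by move: sz => /=; rewrite ew cats0 size_path_of; lia.
Qed.

(** [b] is the letter preceding [w]; with [b = U] no valley arises at the front. *)
Fixpoint valleys_from (b : bool) (w : seq bool) : nat :=
  if w is c :: w' then ~~ b && c + valleys_from c w' else 0.

Lemma valleys_from_cat b x y :
  valleys_from b (x ++ y) = valleys_from b x + valleys_from (last b x) y.
Proof. by elim: x b => //= c x IHx b; rewrite IHx addnA. Qed.

Lemma card_set_ord m (P : pred nat) : #|[set j : 'I_m | P j]%SET| = \sum_(j < m) P j.
Proof. by rewrite -sum1dep_card big_mkcond; apply: eq_bigr => j _; case: (P j). Qed.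

Lemma valleysE w : valleys w = valleys_from U w.
Proof.
rewrite /valleys (card_set_ord _ (fun j => (nth U w j == D) && (nth U w j.+1 == U))).
case: w => [|b w] /=; first by rewrite big_ord0.
elim: w b => [|c w IHw] b /=; first by rewrite big_ord0.
rewrite big_ord_recl /= IHw.
by case: b; case: c.
Qed.

(** In [U q D p] the only valley outside the codes of [q] and [p] is formed by [D] and the first [U]
    of [p], so it is there iff [p] is not a leaf. *)
Lemma valleys_path_of t : valleys (path_of t) = left_edges t.
Proof.
rewrite valleysE; elim: t => //= p IHp q IHq.
rewrite valleys_from_cat IHq /= andbF add0n -IHp.
by case: p {IHp} => [|p p'] /=; lia.
Qed.

(** * The number of Dyck paths *)

Fixpoint balanced_words (m h : nat) : seq (seq bool) :=
  if m is m'.+1 then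
    [seq U :: w | w <- balanced_words m' h.+1]
    ++ (if h is h'.+1 then [seq D :: w | w <- balanced_words m' h'] else [::])
  else if h == 0 then [:: [::]] else [::].

Lemma mem_balanced_words m h w :
  (w \in balanced_words m h) = (size w == m) && balanced h w.
Proof.
have memU b c x (s : seq (seq bool)) : (b :: x \in [seq c :: y | y <- s]) = (b == c) && (x \in s).
  apply/mapP/andP => [[y ys [-> ->]]|[/eqP-> xs]]; first by rewrite eqxx.
  by exists x.
have mem0 c (s : seq (seq bool)) : ([::] \in [seq c :: y | y <- s]) = false.
  by apply/mapP => -[].
elim: m h w => [|m IHm] h w /=.
  by case: h => [|h]; case: w => [|[] w].
rewrite mem_cat; case: w => [|b w].
  by case: h => [|h]; rewrite !mem0.
by case: h => [|h]; rewrite !memU ?IHm; case: b => /=; rewrite ?orbF ?andbF.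
Qed.

Lemma balanced_words_uniq m h : uniq (balanced_words m h).
Proof.
elim: m h => [|m IHm] h /=; first by case: h.
have consI b : injective (cons b : seq bool -> _) by move=> x y [].
rewrite cat_uniq map_inj_uniq // IHm /=; case: h => [|h] //=.
rewrite map_inj_uniq // IHm andbT; apply/hasPn => x /mapP[y _ ->].
by apply/mapP => -[].
Qed.

Lemma balanced_words_nil m h : m < h -> balanced_words m h = [::].
Proof.
elim: m h => [|m IHm] [|h] //= lt.
by rewrite !IHm //; lia.
Qed.

(* Ballot numbers C(m, u) - C(m, u-1), stated without subtraction. *)
Lemma size_balanced_words m u h : m = 2 * u + h ->
  size (balanced_words m h) + (if u is u'.+1 then 'C(m, u') else 0) = 'C(m, u).
Proof.
elim: m u h => [|m IHm] u h em.
  have -> : u = 0 by lia.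
  by have -> : h = 0 by lia.
rewrite /= size_cat size_map.
case: u em => [|u] em.
  rewrite balanced_words_nil /=; last by lia.
  case: h em => [|h] em; first by lia.
  by rewrite size_map; have := IHm 0 h ltac:(lia); rewrite !bin0.
have := IHm u h.+1 ltac:(lia).
case: h em => [|h] em.
  (* At height 0 there is no down step. The ballot difference it would contribute vanishes by
     symmetry, as [m = 2 * u + 1]. *)
  have e : 'C(m, u.+1) = 'C(m, u).
    by rewrite -bin_sub; [congr 'C(_, _); lia|lia].
  case: u em e => [|u] em e; rewrite !binS ?bin0 e ?bin0 /=; first by lia.
  by rewrite addn0; lia.
have := IHm u.+1 h ltac:(lia).
rewrite size_map.
by case: u em => [|u] em; rewrite !binS ?bin0 /=; lia.
Qed.

Lemma size_balanced_words_catalan n : size (balanced_words (2 * n) 0) = catalan n.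
Proof.
have := size_balanced_words (m := 2 * n) (u := n) (h := 0) ltac:(lia).
have := catalan_exact n.
case: n => [|n]; first by rewrite /= bin0; lia.
(* With N = n+1 this reads N C(2N,N) = (N+1) C(2N,N-1), so the ballot difference is
   C(2N,N)/(N+1). *)
have := mul_bin_left (2 * n.+1) n.
by nia.
Qed.

Lemma nth_bij (T : eqType) (x0 : T) (s : seq T) : uniq s ->
  set_bij `I_(size s)%classic [set x | x \in s]%classic (nth x0 s).
Proof.
move=> us; split.
- by move=> i /= lti; exact: mem_nth.
- by move=> i j; rewrite !inE /= => lti ltj /eqP; rewrite nth_uniq // => /eqP.
- by move=> x /= xs; exists (index x s); rewrite ?nth_index //= index_mem.
Qed.

Lemma card_Dyck n : (Dyck n #= `I_(catalan n))%card.
Proof.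
have -> : Dyck n = [set w | w \in balanced_words (2 * n) 0]%classic.
  apply/seteqP; split=> w /=; rewrite mem_balanced_words.
    by move=> /dyck_pathE[-> ->]; rewrite eqxx.
  by move=> /andP[/eqP sz bw]; apply/dyck_pathE.
rewrite -size_balanced_words_catalan; apply/card_set_bijP; eexists.
exact: (bijpinv_bij (fun=> 0) (nth_bij [::] (balanced_words_uniq (2 * n) 0))).
Qed.

(** * Trees and height sequences *)

(** Preorder listing of the nodes, each labelled by [h] plus the number of left edges above it. *)
Fixpoint heights (h : nat) (t : tree) : seq nat :=
  if t is Node p q then h :: heights h.+1 p ++ heights h q else [::].

Definition climb : rel nat := fun x y => y <= x.+1.

Fixpoint ascents (x : nat) (s : seq nat) : nat :=
  if s is y :: s' then (y == x.+1) + ascents y s' else 0.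

Lemma ascents_cat x s s' :
  ascents x (s ++ s') = ascents x s + ascents (last x s) s'.
Proof. by elim: s x => //= y s IHs x; rewrite IHs addnA. Qed.

Lemma size_heights h t : size (heights h t) = tsize t.
Proof. by elim: t h => //= p IHp q IHq h; rewrite size_cat IHp IHq. Qed.

Lemma last_heights_ge k x h t : k <= h -> k <= x -> k <= last x (heights h t).
Proof.
elim: t x h => //= p IHp q IHq x h kh kx.
by rewrite last_cat; apply: IHq => //; apply: IHp => //; apply: leqW.
Qed.

Lemma path_heights x h t : h <= x.+1 -> path climb x (heights h t).
Proof.
elim: t x h => //= p IHp q IHq x h le.
rewrite cat_path {1}/climb le IHp //= IHq // leqW //.
exact: last_heights_ge.
Qed.

Lemma ascents_heights x h t :
  ascents x (heights h t) = (nonleaf t && (h == x.+1)) + left_edges t.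
Proof.
elim: t x h => //= p IHp q IHq x h.
rewrite ascents_cat IHp IHq eqxx andbT.
(* The right subtree restarts at [h], not above the letter before it, so it opens with no ascent. *)
have : h <= last h (heights h.+1 p) by apply: last_heights_ge.
by case: (nonleaf q) => /=; lia.
Qed.

(** All letters of [heights h t] are at least [h], so the first letter below [h] marks where the
    tree ends. *)
Lemma heights_cat_inj h t t' z z' :
  (forall x, ohead z = Some x -> x < h) -> (forall x, ohead z' = Some x -> x < h) ->
  heights h t ++ z = heights h t' ++ z' -> t = t' /\ z = z'.
Proof.
have head_low t0 h0 z0 : (forall x, ohead z0 = Some x -> x < h0) ->
    forall x, ohead (heights h0 t0 ++ z0) = Some x -> x < h0.+1.
  by case: t0 => [|p q] lt x /= => [/lt /ltnW|[<-]].
elim: t t' h z z' => [|p IHp q IHq] [|p' q'] h z z' lt lt' //=.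
- by move=> ez; move: (lt h); rewrite ez /= ltnn => /(_ erefl).
- by move=> ez; move: (lt' h); rewrite -ez /= ltnn => /(_ erefl).
case; rewrite -!catA => /IHp[]; try exact: head_low.
by move=> -> /IHq[] // -> ->.
Qed.

Lemma heights_inj h : injective (heights h).
Proof.
move=> t t' e.
by case: (@heights_cat_inj h t t' [::] [::]) => //; rewrite e.
Qed.

Fixpoint forest_heights (ts : seq tree) : seq nat :=
  if ts is t :: ts' then heights (size ts') t ++ forest_heights ts' else [::].

Lemma forest_heights_leaves k ts :
  forest_heights (nseq k Leaf ++ ts) = forest_heights ts.
Proof. by elim: k. Qed.

(** One tree for each level from [x+1] down to 0. A first letter [y] joins the trees that follow it
    at levels [y+1] and [y] into one node at level [y]; leaves fill the levels above. *)
Lemma climb_forest x s : path climb x s ->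
  exists ts, size ts = x.+2 /\ s = forest_heights ts.
Proof.
elim: s x => [|y s IHs] x /=.
  by exists (nseq x.+2 Leaf); rewrite size_nseq -[nseq _ _]cats0 forest_heights_leaves.
move=> /andP[le /IHs[[|t [|t' ts]] [//= [szts] ->]]].
exists (nseq (x.+1 - y) Leaf ++ Node t t' :: ts).
rewrite forest_heights_leaves size_cat size_nseq /= szts -catA; split=> //.
by move: le; rewrite /climb; lia.
Qed.

(** * Height sequences and repetition sequences *)

(* The state after reading a prefix is [(M, r, l)]: the least nonzero letter that
   can follow without creating 021, the number of repetitions, the last letter.
   [slack] records r + 1 - M after each letter. *)
Fixpoint slack (M r l : nat) (a : seq nat) : seq nat :=
  if a is v :: a' then
    let M' := if v == 0 then M else v in
    let r' := r + (v == l) in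
    (r'.+1 - M') :: slack M' r' v a'
  else [::].

(** A slack one larger than before means a repetition. An unchanged slack after a nonzero letter
    means 0, since [r.+1 - y] would then be [M = l], a repetition. Otherwise the letter is a nonzero
    one that becomes the new [M]. *)
Fixpoint unslack (M r l : nat) (s : seq nat) : seq nat :=
  if s is y :: s' then
    let v := if y + M == r.+2 then l
             else if (l != 0) && (y + M == r.+1) then 0 else r.+1 - y in
    v :: unslack (if v == 0 then M else v) (r + (v == l)) v s'
  else [::].

Fixpoint bounded_by_reps (r l : nat) (a : seq nat) : bool :=
  if a is v :: a' then (v <= r.+1) && bounded_by_reps (r + (v == l)) v a' else true.

Fixpoint nonzero_nondecr (M : nat) (a : seq nat) : bool :=
  if a is v :: a' then
    ((v == 0) || (M <= v)) && nonzero_nondecr (if v == 0 then M else v) a'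
  else true.

Fixpoint reps (l : nat) (a : seq nat) : nat :=
  if a is v :: a' then (v == l) + reps v a' else 0.

Definition state (M r l : nat) : Prop := [/\ 0 < M, M <= r.+1 & l = 0 \/ l = M].

Lemma slackK M r l a : state M r l -> bounded_by_reps r l a -> nonzero_nondecr M a ->
  unslack M r l (slack M r l a) = a.
Proof.
elim: a M r l => //= v a IHa M r l [M0 Mr lM] /andP[vr bnd] /andP[vM inc].
set M' := if v == 0 then M else v in inc *.
set y := (r + (v == l)).+1 - M'.
have -> : (if y + M == r.+2 then l
    else if (l != 0) && (y + M == r.+1) then 0 else r.+1 - y) = v.
  by rewrite /y /M'; case: (eqVneq v 0) vM => /= *; do ?case: ifP => //; lia.
rewrite -/M' IHa // /M'; split; case: (eqVneq v 0) vM => /=; lia.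
Qed.

Lemma unslackP M r l s : state M r l -> path climb (r.+1 - M) s ->
  [/\ slack M r l (unslack M r l s) = s, bounded_by_reps r l (unslack M r l s)
    & nonzero_nondecr M (unslack M r l s)].
Proof.
elim: s M r l => //= y s IHs M r l [M0 Mr lM] /andP[le ps].
move: le; rewrite /climb => le.
set v := if y + M == r.+2 then _ else _.
have vE : [\/ y + M = r.+2 /\ v = l, [/\ 0 < l, y + M = r.+1 & v = 0]
  | [/\ y + M <= r.+1, v = r.+1 - y & v != l]].
  rewrite /v; case: ifP => [|ne]; first by move=> /eqP; constructor.
  case: ifP => [/andP[l0 /eqP] |]; first by constructor 2; split; lia.
  by constructor 3; split; lia.
move: v vE => v vE; set M' := if v == 0 then M else v.
have ey : (r + (v == l)).+1 - M' = y.
  by rewrite /M'; case: vE => -[]; case: (eqVneq v 0); lia.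
have st' : state M' (r + (v == l)) v.
  by rewrite /M'; split; case: vE => -[]; case: (eqVneq v 0); lia.
have [] := IHs _ _ _ st'; first by rewrite ey.
move=> -> -> ->; rewrite ey !andbT; split=> //.
  by case: vE => -[]; lia.
by case: vE => -[]; lia.
Qed.

Lemma path_slack M r l a : state M r l ->
  bounded_by_reps r l a -> nonzero_nondecr M a ->
  path climb (r.+1 - M) (slack M r l a).
Proof.
elim: a M r l => //= v a IHa M r l [M0 Mr lM] /andP[vr bnd] /andP[vM inc].
rewrite IHa // ?andbT /climb.
  by case: (eqVneq v l) lM vM; case: (eqVneq v 0) => /=; lia.
by split; case: (eqVneq v 0) vM => /=; lia.
Qed.

(** A repetition raises [r] and keeps [M], as [l] is 0 or [M]. Any other letter keeps [r] and does
    not lower [M], so the slack does not rise. *)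
Lemma ascents_slack M r l a : state M r l ->
  bounded_by_reps r l a -> nonzero_nondecr M a ->
  ascents (r.+1 - M) (slack M r l a) = reps l a.
Proof.
elim: a M r l => //= v a IHa M r l [M0 Mr lM] /andP[vr bnd] /andP[vM inc].
rewrite IHa //; last by split; case: (eqVneq v 0) vM => /=; lia.
congr (nat_of_bool _ + _).
by case: (eqVneq v l) lM vM; case: (eqVneq v 0) => /=; lia.
Qed.

Lemma size_slack M r l a : size (slack M r l a) = size a.
Proof. by elim: a M r l => //= v a IHa M r l; rewrite IHa. Qed.

Lemma size_unslack M r l s : size (unslack M r l s) = size s.
Proof. by elim: s M r l => //= v a IHa M r l; rewrite IHa. Qed.

(** * Recursive form of the 021-avoiding repetition sequences *)

Lemma nrepsE a m : nreps a m = \sum_(j < m) (nth 0 a j == nth 0 a j.+1).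
Proof. exact: card_set_ord (fun j => nth 0 a j == nth 0 a j.+1). Qed.

Lemma nreps_cons l v a m : nreps (l :: v :: a) m.+1 = (v == l) + nreps (v :: a) m.
Proof. by rewrite !nrepsE big_ord_recl /= [v == l]eq_sym. Qed.

Lemma repsE l a : nreps (l :: a) (size a) = reps l a.
Proof.
elim: a l => [|v a IHa] l /=; first by rewrite nrepsE big_ord0.
by rewrite nreps_cons IHa.
Qed.

Lemma bounded_by_repsP r l a :
  reflect (forall i, i < size a -> nth 0 a i <= r.+1 + nreps (l :: a) i)
          (bounded_by_reps r l a).
Proof.
elim: a r l => [|v a IHa] r l /=; first by constructor.
apply: (iffP andP) => [[vr /IHa bnd] [|i] lti /=|bnd].
- by rewrite nrepsE big_ord0 addn0.
- by rewrite nreps_cons; have := bnd _ lti; lia.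
split; first by have := bnd 0 isT; rewrite nrepsE big_ord0 addn0.
by apply/IHa => i lti; have /= := bnd i.+1 lti; rewrite nreps_cons; lia.
Qed.

Lemma nonzero_nondecrE M a : 0 < M ->
  nonzero_nondecr M a = pairwise (fun x y => (0 < y) ==> (x <= y)) (M :: a).
Proof.
elim: a M => //= v a IHa M M0; case: (posnP v) => [->|v0] /=.
  rewrite IHa //=; case: (pairwise _ a); rewrite ?andbF // !andbT.
  by rewrite [X in _ = _ && X](eq_all (a2 := predT)) ?all_predT ?andbT // => -[].
rewrite IHa //=; case: leqP => //= Mv.
case: (boolP (all (fun y => (0 < y) ==> (v <= y)) a)) => [allv|_] /=;
  last by rewrite andbF.
suff -> : all (fun y => (0 < y) ==> (M <= y)) a by [].
by apply: sub_all allv => y /implyP le; apply/implyP => /le; apply: leq_trans.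
Qed.

(** The leading 0 serves as the smallest letter of a 021 for any descent between nonzero letters. *)
Lemma avoids021_cons0 a : avoids021 (0 :: a) <-> nonzero_nondecr 1 a.
Proof.
have -> : nonzero_nondecr 1 a = pairwise (fun x y => (0 < y) ==> (x <= y)) (0 :: a).
  rewrite nonzero_nondecrE //=; congr (_ && _).
  by apply: eq_all => -[].
split=> [av|/(pairwiseP 0) mono [i [j [k [ij jk ksz /andP[ik kj]]]]]].
  apply/(pairwiseP 0) => j k; rewrite !inE => jsz ksz jk.
  apply/implyP => ak; rewrite leqNgt; apply/negP => kj; apply: av.
  exists 0, j, k; split; rewrite ?ak //.
  by case: j kj {jsz jk}.
have := mono j k; rewrite !inE => /(_ (ltn_trans jk ksz) ksz jk).
by rewrite (leq_ltn_trans _ ik) //= leqNgt kj.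
Qed.

Lemma R021E n a : R021 n.+1 a <->
  exists b, [/\ a = 0 :: b, size b = n, bounded_by_reps 0 0 b & nonzero_nondecr 1 b].
Proof.
split=> [[[sz a0 bnd] av]|[b [-> sz /bounded_by_repsP bnd inc]]]; last first.
  split; last exact/avoids021_cons0.
  by split=> [/=||[|i] //]; [rewrite sz| |rewrite /= ltnS -sz => /bnd].
case: a sz a0 bnd av => [//|x b] /= [sz] -> bnd /avoids021_cons0 inc.
exists b; split=> //; apply/bounded_by_repsP => i lti.
by apply: (bnd i.+1); rewrite -sz.
Qed.

(** The first letter 0 leaves the state [(1, 0, 0)] of slack 0, the height of the root; only the
    later heights are decoded. *)
Definition seq_of (t : tree) : seq nat := 0 :: unslack 1 0 0 (behead (heights 0 t)).

Lemma state0 : state 1 0 0. Proof. by split=> //; left. Qed.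

Lemma path_behead_heights t : path climb 0 (behead (heights 0 t)).
Proof.
have := @path_heights 0 0 t isT.
by case: t => //= p q /andP[].
Qed.

Lemma slack_seq_of t : slack 1 0 0 (behead (seq_of t)) = behead (heights 0 t).
Proof. by have [] := unslackP state0 (path_behead_heights t). Qed.

Lemma seq_of_bij n : set_bij [set t | tsize t = n.+1]%classic (R021 n.+1) seq_of.
Proof.
split.
- move=> t sz; apply/R021E; exists (behead (seq_of t)).
  have [_ bnd inc] := unslackP state0 (path_behead_heights t).
  by split=> //; rewrite size_unslack size_behead size_heights sz.
- move=> t t'; rewrite !inE /= => sz sz' e.
  apply: (@heights_inj 0); have := slack_seq_of t; rewrite e slack_seq_of.
  by case: t sz {e} => // p q _; case: t' sz' => //= p' q' _ ->.
- move=> a /R021E[b [-> szb bnd inc]].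
  have := path_slack state0 bnd inc.
  (* From slack 0 there are two trees, at levels 1 and 0: the subtrees of the root. *)
  move=> /climb_forest[[|p [|q [|? ?]]] [] //= _]; rewrite cats0 => es.
  have hE : behead (heights 0 (Node p q)) = slack 1 0 0 b by rewrite es.
  exists (Node p q); last by rewrite /seq_of hE slackK //; exact: state0.
  by rewrite /= -szb -(size_slack 1 0 0 b) es size_cat !size_heights.
Qed.

Lemma repetitions_seq_of t : repetitions (seq_of t) = left_edges t.
Proof.
rewrite /repetitions /seq_of [_.-1]/= repsE.
have [es bnd inc] := unslackP state0 (path_behead_heights t).
rewrite -(ascents_slack state0 bnd inc) es.
(* Restoring the root's height 0 after the starting value 0 adds no ascent. *)
have := ascents_heights 0 0 t; rewrite andbF add0n => <-.
by case: t {es bnd inc}.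
Qed.

Theorem mainTheorem2 (n : nat) (n_ge1 : 1 <= n) :
  (exists f : seq nat -> seq bool,
      set_bij (R021 n) (Dyck n) f /\
      (forall a : seq nat, R021 n a -> valleys (f a) = repetitions a))
  /\ (R021 n #= `I_(catalan n))%card.
Proof.
case: n n_ge1 => // n _.
set tree_of := 'pinv_(fun=> Leaf) [set t | tsize t = n.+1]%classic seq_of.
have tree_of_bij : set_bij (R021 n.+1) [set t | tsize t = n.+1]%classic tree_of.
  exact: bijpinv_bij (seq_of_bij n).
have f_bij := set_bij_comp tree_of_bij (path_of_bij n.+1).
split; last first.
  have /card_set_bijP[g g_bij] := card_Dyck n.+1.
  apply/card_set_bijP; exists (g \o (path_of \o tree_of)).
  exact: set_bij_comp f_bij g_bij.
exists (path_of \o tree_of); split=> // a Ra /=.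
have [_ _ /(_ a Ra)[t szt <-]] := seq_of_bij n.
rewrite repetitions_seq_of valleys_path_of /tree_of pinvKV ?inE //.
by have [_ inj _] := seq_of_bij n.
Qed.
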